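(* Let $r\in\mathbb{Z}$ with $|r|\ge2$, and let $u,v\in\mathbb{R}$ with $0<u<v$. Then for every $q\ge1$, $$\left|A(u^{r},v^{r})-L_r^{r}(u,v)\right|\le\frac{(v-u)|r|}{2^{\frac{q-1}{q}+1}}\,A^{\frac1q}\left(|u|^{q(r-1)},|v|^{q(r-1)}\right).$$
   Context: For $u,v>0$: $A(u,v)=\frac{u+v}{2}$ is the arithmetic mean, and for $r\in\mathbb{Z}\setminus\{-1,0\}$ and $u\neq v$, $L_r(u,v)=\left[\frac{v^{r+1}-u^{r+1}}{(v-u)(r+1)}\right]^{1/r}$ is the generalized logarithmic mean. $L_r^r(u,v)=(L_r(u,v))^r$ and $A^{1/q}(a,b)=(A(a,b))^{1/q}$. *)

(* Defs.v *)
From mathcomp Require Import all_boot all_order all_algebra.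
From mathcomp Require Import reals exp.

Set Implicit Arguments.
Unset Strict Implicit.
Unset Printing Implicit Defensive.

Import Order.TTheory GRing.Theory Num.Theory.

Local Open Scope ring_scope.

Section Means.
Context {R : realType}.

Definition arith_mean (u v : R) : R := (u + v) / 2.

(* Meaningful for 0 < u, 0 < v, u != v and r not in {-1, 0}; the base of the
   outer power is then positive. The inner powers are integer powers, the outer
   one, of exponent 1/r, is the real power powR. *)
Definition gen_log_mean (r : int) (u v : R) : R :=
  ((v ^ (r + 1) - u ^ (r + 1)) / ((v - u) * (r + 1)%:~R)) `^ (1 / r%:~R).

End Means.

(* Main.v *)
Require Import Defs.
From mathcomp Require Import all_boot all_order all_algebra.
From mathcomp Require Import interval_inference reals convex exp hoelder.
From mathcomp Require Import zify ring lra.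

(** The number L_r^r(u,v) is the integral mean of x^r over [u,v], so the left-hand
    side is the error of the trapezoid rule. For integer r this error has a
    purely algebraic form: expanding (a^(n+1) - b^(n+1)) / (a - b) as a
    geometric sum turns it, up to a constant factor, into
      D_n(a,b) = sum_(0 <= i <= n) (a^i - b^i) (a^(n-i) - b^(n-i)),
    as in Chebyshev's sum inequality ([chebyshev_sumE]). For r = n > 0 one
    takes a = v, b = u; for r = -n < 0 one takes a = 1/u, b = 1/v.

    For 0 <= b <= a every summand is nonnegative and at most
    min(i, n-i) (a - b) (a^(n-1) - b^(n-1)), by the mean value estimate
    a^k - b^k <= k (a - b) a^(k-1) ([subXX_le]). The minima add up to at most
    n^2/4, which gives [chebyshev_sum_le].
    Dividing by the constant (n + 1 for r = n, n - 1 for r = -n) gives, in both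
    cases, the error bound
      (v - u) |r| / 4 * A(u^(r-1), v^(r-1))           ([trapezoid_exprz]).
    For negative r the factor n / (n - 1) is in excess; it is absorbed by the
    Bernoulli-type inequality [mul_subXX_bernoulli].

    This bound implies the one for every q >= 1: the power mean of exponent q
    dominates the arithmetic mean ([arith_mean_powR_le]), and
    2^((q-1)/q + 1) <= 2^2 = 4. *)

Import Order.TTheory GRing.Theory Num.Theory.

Local Open Scope ring_scope.
(** * Sums of products of differences of powers *)

Lemma sum_minn_compl_le (n : nat) :
  (4 * \sum_(i < n.+1) minn i (n - i) <= n ^ 2)%N.
Proof.
(* Removing both end terms, which vanish, and lowering the remaining minima by
   one leaves the sum for n - 2, so the induction goes in steps of two; the
   n + 1 units removed are ((n + 2)^2 - n^2) / 4. *)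
have [k] := ubnP n; elim: k n => // k IH [|[|n]] nk; first by rewrite big_ord1.
  by rewrite !big_ord_recl big_ord0.
rewrite big_ord_recl big_ord_recr /= /bump /= min0n add1n subnn minn0 add0n addn0.
under eq_bigr => i _.
  rewrite add1n subSS subSn ?minnSS -1?ltnS // -addn1; over.
rewrite big_split /= sum1_card card_ord mulnDr.
apply: leq_trans (leq_add (IH n _) (leqnn _)) _; first by rewrite ltnS in nk; apply: leq_trans nk.
lia.
Qed.

(** The mean value estimate for x^(n+1), whose derivative is largest at a. *)
Lemma subXX_le {R : realDomainType} (a b : R) (n : nat) : 0 <= b -> b <= a ->
  a ^+ n.+1 - b ^+ n.+1 <= n.+1%:R * (a - b) * a ^+ n.
Proof.
move=> b0 ba; elim: n => [|n IH]; first by rewrite !expr1 expr0; lra.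
have bna : (a - b) * b ^+ n.+1 <= (a - b) * a ^+ n.+1.
  by rewrite ler_wpM2l ?subr_ge0 // lerXn2r ?nnegrE // (le_trans b0).
have := ler_wpM2l (le_trans b0 ba) IH.
rewrite [a ^+ n.+2]exprS [b ^+ n.+2]exprS (exprS a n) [n.+2%:R]mulrSr in bna *.
lra.
Qed.

(** With i the smaller index, [subXX_le] bounds the first factor by
    i (a - b) a^(i-1), and a^(i-1) (a^j - b^j) <= a^(i+j-1) - b^(i+j-1) because
    b <= a. Choosing the smaller index is what makes the sum over i + j = n
    of order n^2/4, the constant needed in the end. *)
Lemma mul_subXX_le {R : realDomainType} (a b : R) (i j : nat) :
  0 <= b -> b <= a ->
  (a ^+ i - b ^+ i) * (a ^+ j - b ^+ j) <=
    (minn i j)%:R * ((a - b) * (a ^+ (i + j).-1 - b ^+ (i + j).-1)).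
Proof.
move=> b0 ba; have a0 := le_trans b0 ba.
wlog ij : i j / (i <= j)%N.
  move=> H; case/orP: (leq_total i j) => [|/H]; first exact: H.
  by rewrite mulrC minnC addnC.
rewrite (minn_idPl ij); case: i ij => [_|i ij]; first by rewrite !expr0 subrr !mul0r.
have Xle k : b ^+ k <= a ^+ k by rewrite lerXn2r // nnegrE.
apply: le_trans (ler_wpM2r _ (subXX_le _ _ i b0 ba)) _; first by rewrite subr_ge0.
rewrite -!mulrA ler_wpM2l // ler_wpM2l ?subr_ge0 // addSn /= mulrBr -exprD lerB //.
by rewrite exprD ler_wpM2r ?exprn_ge0.
Qed.

Definition chebyshev_sum {R : pzRingType} (n : nat) (a b : R) : R :=
  \sum_(i < n.+1) (a ^+ i - b ^+ i) * (a ^+ (n - i) - b ^+ (n - i)).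

(** Each summand expands to a^n + b^n - a^i b^(n-i) - a^(n-i) b^i, and the mixed
    terms form two copies of the geometric sum. *)
Lemma chebyshev_sumE {R : comPzRingType} (n : nat) (a b : R) :
  (a - b) * chebyshev_sum n a b =
  n.+1%:R * ((a - b) * (a ^+ n + b ^+ n)) - 2 * (a ^+ n.+1 - b ^+ n.+1).
Proof.
have geom x y := @subrXX R x y n.+1.
have -> : 2 * (a ^+ n.+1 - b ^+ n.+1) =
    (a ^+ n.+1 - b ^+ n.+1) - (b ^+ n.+1 - a ^+ n.+1) :> R by ring.
rewrite (geom a b) (geom b a) -(opprB a b) mulNr opprK mulrCA -mulrDr -mulrBr.
congr (_ * _); rewrite mulr_natl -[X in _ *+ X - _](card_ord n.+1) -sumr_const.
rewrite -big_split -sumrB; apply: eq_bigr => i _ /=.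
rewrite mulrBr !mulrBl -!exprD subnKC -1?ltnS //; ring.
Qed.

Lemma chebyshev_sum_ge0 {R : realDomainType} (n : nat) (a b : R) :
  0 <= b -> b <= a -> 0 <= chebyshev_sum n a b.
Proof.
move=> b0 ba; apply: sumr_ge0 => i _.
by rewrite mulr_ge0 // subr_ge0 lerXn2r // nnegrE // (le_trans b0).
Qed.

Lemma chebyshev_sum_le {R : realDomainType} (n : nat) (a b : R) :
  0 <= b -> b <= a ->
  4 * chebyshev_sum n a b <= n%:R ^+ 2 * ((a - b) * (a ^+ n.-1 - b ^+ n.-1)).
Proof.
move=> b0 ba; have a0 := le_trans b0 ba.
pose M := (a - b) * (a ^+ n.-1 - b ^+ n.-1).
have M0 : 0 <= M by rewrite mulr_ge0 // subr_ge0 // lerXn2r // nnegrE.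
apply: (@le_trans _ _ ((4 * \sum_(i < n.+1) minn i (n - i))%N%:R * M)); last first.
  by rewrite ler_wpM2r // -natrX ler_nat sum_minn_compl_le.
rewrite natrM -mulrA ler_wpM2l // natr_sum mulr_suml; apply: ler_sum => i _.
by have := mul_subXX_le _ _ i (n - i) b0 ba; rewrite subnKC // -ltnS.
Qed.

(** Bernoulli's inequality (n + 1) b a^n <= n a^(n+1) + b^(n+1), in a form that
    gains the factor n / (n + 1) over the trivial bound by a^(n+1). *)
Lemma mul_subXX_bernoulli {R : realDomainType} (a b : R) (n : nat) :
  0 <= b -> b <= a ->
  n.+1%:R * (b * (a ^+ n - b ^+ n)) <= n%:R * a ^+ n.+1.
Proof.
move=> b0 ba; have := subXX_le _ _ n b0 ba.
have : 0 <= n%:R * b ^+ n.+1 by rewrite mulr_ge0 // exprn_ge0.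
rewrite !exprS mulrSr; lra.
Qed.

(** * The power mean inequality *)

Lemma arith_mean_powR_le {R : realType} (x y q : R) :
  0 <= x -> 0 <= y -> 1 <= q ->
  arith_mean x y <= arith_mean (x `^ q) (y `^ q) `^ (1 / q).
Proof.
move=> x0 y0 q1; have q0 : 0 < q by apply: lt_le_trans q1.
have m0 : 0 <= arith_mean x y by rewrite /arith_mean; lra.
rewrite -{1}(powRr1 m0) -{1}(mulfV (lt0r_neq0 q0)) // powRrM div1r.
apply: ge0_ler_powR; rewrite ?nnegrE ?invr_ge0 ?powR_ge0 ?(ltW q0) //.
  by rewrite /arith_mean divr_ge0 // addr_ge0 ?powR_ge0.
have h01 : 0 <= 2^-1 :> R by lra.
have h1 : 2^-1 <= 1 :> R by lra.
have := @convex_powR R q q1 (Itv01 h01 h1) x y.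
rewrite !classical_sets.in_setE /= !in_itv /= !andbT x0 y0 convRE [X in X `^ _ <= _]convRE /= => /(_ isT isT).
rewrite [unstable.onem _](_ : _ = 2^-1); last by rewrite /unstable.onem; lra.
by rewrite /arith_mean !(mulrC _ 2^-1) !mulrDr.
Qed.

(** * The trapezoid rule for integer powers *)

(** The integral mean of x^r over [u, v]. *)
Definition log_mean_base {R : fieldType} (r : int) (u v : R) : R :=
  (v ^ (r + 1) - u ^ (r + 1)) / ((v - u) * (r + 1)%:~R).

Lemma log_mean_base_gt0 {R : realFieldType} (r : int) (u v : R) :
  r != -1 -> 0 < u -> u < v -> 0 < log_mean_base r u v.
Proof.
move=> r1 u0 uv; have v0 := lt_trans u0 uv; rewrite /log_mean_base.
have : r + 1 != 0 by rewrite addr_eq0.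
case: (r + 1) => [[|n] //|n] _.
  by rewrite divr_gt0 ?mulr_gt0 ?subr_gt0 ?ltrXn2r ?nnegrE ?ltW //= ltr0n.
rewrite -divrNN divr_gt0 ?opprB ?subr_gt0 //.
  by rewrite !NegzE -!exprnN ltf_pV2 ?posrE ?exprn_gt0 // ltrXn2r ?nnegrE ?ltW.
by rewrite -mulrN mulr_gt0 ?subr_gt0 // NegzE mulrNz opprK ltr0n.
Qed.

Lemma gen_log_meanX {R : realType} (r : int) (u v : R) :
  r != 0 -> r != -1 -> 0 < u -> u < v ->
  gen_log_mean r u v ^ r = log_mean_base r u v.
Proof.
move=> r0 r1 u0 uv; have b0 := ltW (log_mean_base_gt0 _ _ _ r1 u0 uv).
rewrite /gen_log_mean -powR_intmul ?powR_ge0 // -powRrM mulfVK ?intr_eq0 //.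
by rewrite powRr1.
Qed.

Lemma trapezoid_exprn {R : realFieldType} (n : nat) (u v : R) :
  0 <= u -> u < v ->
  `|(u ^+ n + v ^+ n) / 2 - (v ^+ n.+1 - u ^+ n.+1) / ((v - u) * n.+1%:R)| <=
    (v - u) * n%:R / 4 * ((u ^+ n.-1 + v ^+ n.-1) / 2).
Proof.
move=> u0 uv; have vu : 0 < v - u by rewrite subr_gt0.
have n1 : 0 < n.+1%:R :> R by rewrite ltr0n.
have -> : (u ^+ n + v ^+ n) / 2 - (v ^+ n.+1 - u ^+ n.+1) / ((v - u) * n.+1%:R) =
    chebyshev_sum n v u / (2 * n.+1%:R).
  have E : 2 * (v ^+ n.+1 - u ^+ n.+1) =
      n.+1%:R * ((v - u) * (v ^+ n + u ^+ n)) - (v - u) * chebyshev_sum n v u.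
    by rewrite chebyshev_sumE subKr.
  have -> : v ^+ n.+1 - u ^+ n.+1 =
    (n.+1%:R * ((v - u) * (v ^+ n + u ^+ n)) - (v - u) * chebyshev_sum n v u) / 2.
    by rewrite -E mulrAC divff ?mul1r.
  by field; rewrite !gt_eqF.
rewrite ger0_norm; last by rewrite divr_ge0 ?chebyshev_sum_ge0 ?mulr_ge0 // ltW.
rewrite ler_pdivrMr ?mulr_gt0 //.
have := chebyshev_sum_le n v u u0 (ltW uv).
(* This is four times the difference of the two sides after the previous bound. *)
have : 0 <= n%:R * (v - u) * (n.+1%:R * u ^+ n.-1 + v ^+ n.-1 + n%:R * u ^+ n.-1).
  have v0 : 0 <= v by apply: le_trans (ltW uv).
  rewrite mulr_ge0 ?mulr_ge0 ?ler0n ?(ltW vu) //.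
  by rewrite !addr_ge0 ?mulr_ge0 ?ler0n ?exprn_ge0.
rewrite -natr1; lra.
Qed.

(** The trapezoid estimate for x^(-n-2) between 1/a and 1/b, rewritten in a and b.
    Here the numerator of the integral mean has the lower degree n + 1: the two
    extreme terms a^(n+2) and b^(n+2) of the geometric sum drop out, and the
    normalisation becomes n + 1 instead of n + 3. *)
Lemma trapezoid_exprV {R : realFieldType} (n : nat) (a b : R) :
  0 < b -> b < a ->
  `|(a ^+ n.+2 + b ^+ n.+2) / 2 - (a ^+ n.+1 - b ^+ n.+1) / ((b^-1 - a^-1) * n.+1%:R)| <=
    (b^-1 - a^-1) * n.+2%:R / 4 * ((a ^+ n.+3 + b ^+ n.+3) / 2).
Proof.
move=> b0 ba; have a0 := lt_trans b0 ba; have ab : 0 < a - b by rewrite subr_gt0.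
have n1 : 0 < n.+1%:R :> R by rewrite ltr0n.
have n2 : 0 < n.+2%:R :> R by rewrite ltr0n.
have -> : (a ^+ n.+2 + b ^+ n.+2) / 2 -
      (a ^+ n.+1 - b ^+ n.+1) / ((b^-1 - a^-1) * n.+1%:R) =
    chebyshev_sum n.+2 a b / (2 * n.+1%:R).
  have := chebyshev_sumE n.+2 a b; move/(canRL (mulKf (lt0r_neq0 ab))) => ->.
  rewrite (exprS _ n.+2) (exprS b n.+2) !(exprS _ n.+1).
  rewrite -[n.+3%:R]/(2 + n.+1)%:R natrD.
  by field; rewrite !gt_eqF.
rewrite ger0_norm; last by rewrite divr_ge0 ?chebyshev_sum_ge0 ?mulr_ge0 // ltW.
rewrite ler_pdivrMr ?mulr_gt0 // -(ler_pM2l (mulr_gt0 (ltr0Sn R 3) b0)).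
(* One factor n + 2 of the square is set aside for the Bernoulli-type bound,
   which trades it, together with b, for n + 1 and one more power of a. *)
apply: (@le_trans _ _ (n.+2%:R * (a - b) * (n.+2%:R * (b * (a ^+ n.+1 - b ^+ n.+1))))).
  have := ler_wpM2l (ltW b0) (chebyshev_sum_le n.+2 a b (ltW b0) (ltW ba)).
  rewrite /=; lra.
apply: (@le_trans _ _ (n.+2%:R * (a - b) * (n.+1%:R * a ^+ n.+2))).
  by rewrite ler_wpM2l ?mul_subXX_bernoulli ?mulr_ge0 ?(ltW ab) ?ltW.
have -> : b^-1 - a^-1 = (a - b) / (a * b) by field; rewrite !gt_eqF.
have -> : 4 * b * ((a - b) / (a * b) * n.+2%:R / 4 * ((a ^+ n.+3 + b ^+ n.+3) / 2)
    * (2 * n.+1%:R)) = n.+2%:R * (a - b) * (n.+1%:R * ((a ^+ n.+3 + b ^+ n.+3) / a)).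
  by field; rewrite !gt_eqF.
rewrite ler_wpM2l ?mulr_ge0 ?(ltW ab) // ler_wpM2l // ler_pdivlMr // -exprSr.
by rewrite lerDl exprn_ge0 // ltW.
Qed.

Lemma trapezoid_exprz {R : realFieldType} (r : int) (u v : R) :
  r != 0 -> r != -1 -> 0 < u -> u < v ->
  `|(u ^ r + v ^ r) / 2 - log_mean_base r u v| <=
    (v - u) * `|r|%:~R / 4 * ((u ^ (r - 1) + v ^ (r - 1)) / 2).
Proof.
case: r => [[|n] //|[|n] //] _ _ u0 uv; rewrite /log_mean_base.
  have -> : Posz n.+1 + 1 = n.+2 by lia.
  have -> : Posz n.+1 - 1 = n by lia.
  exact: (trapezoid_exprn n.+1 _ _ (ltW u0) uv).
have v0 := lt_trans u0 uv.
have -> : Negz n.+1 + 1 = - n.+1%:Z by lia.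
have -> : Negz n.+1 - 1 = - n.+3%:Z by lia.
have -> : `|Negz n.+1| = n.+2 :> int by [].
rewrite NegzE -!exprnN -!exprVn.
have := trapezoid_exprV n u^-1 v^-1; rewrite invr_gt0 v0 ltf_pV2 ?posrE // uv.
rewrite !invrK => /(_ isT isT).
suff -> : (v^-1 ^+ n.+1 - u^-1 ^+ n.+1) / ((v - u) * (- n.+1%:Z)%:~R) =
    (u^-1 ^+ n.+1 - v^-1 ^+ n.+1) / ((v - u) * n.+1%:R) by [].
by rewrite mulrNz mulrN invrN mulrN -mulNr opprB.
Qed.

(** * From the trapezoid estimate to all exponents q *)

Theorem proposition1 (R : realType) (r : int) (hr : 2 <= `|r|)
    (u v : R) (hu : 0 < u) (huv : u < v) (q : R) (hq : 1 <= q) :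
  `|arith_mean (u ^ r) (v ^ r) - (gen_log_mean r u v) ^ r| <=
  ((v - u) * `|r|%:~R) / (2 `^ ((q - 1) / q + 1)) *
  (arith_mean (`|u| `^ (q * (r - 1)%:~R)) (`|v| `^ (q * (r - 1)%:~R)))
    `^ (1 / q).
Proof.
have hv := lt_trans hu huv.
have r0 : r != 0 by lia.
have r1 : r != -1 by lia.
have xqE (x : R) : 0 < x -> `|x| `^ (q * (r - 1)%:~R) = (x ^ (r - 1)) `^ q.
  by move=> x0; rewrite gtr0_norm // mulrC powRrM powR_intmul // ltW.
rewrite gen_log_meanX // !xqE //.
apply: le_trans (trapezoid_exprz _ _ _ r0 r1 hu huv) _.
have C0 : 0 <= (v - u) * `|r|%:~R by rewrite mulr_ge0 ?subr_ge0 ?ler0z ?(ltW huv).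
apply: ler_pM; rewrite ?divr_ge0 ?addr_ge0 ?exprz_ge0 ?(ltW hu) ?(ltW hv) //.
  rewrite ler_wpM2l // lef_pV2 ?posrE ?powR_gt0 //.
  have -> : 4 = 2 `^ 2 :> R by rewrite powR_mulrn // -natrX.
  apply: ler_powR; first by lra.
  rewrite mulrBl divff; last by rewrite gt_eqF // (lt_le_trans _ hq).
  have : 0 <= q^-1 by rewrite invr_ge0 (le_trans _ hq).
  lra.
by apply: arith_mean_powR_le => //; rewrite exprz_ge0 // ltW.
Qed.
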